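(* Let $c,S>0$ and let $[a_1,b_1]\times[a_2,b_2]\subset\mathbb{R}^2$ be a rectangle. Consider the problem $\Sigma$ and, for $0\le\tau<\tau'$, the problem $\Sigma_{\tau,\tau'}$ (both defined in the context). If the data are positive (that is, all initial data and all boundary data are $>0$ at every point), then the solution $N=(N_1,N_2,N_3,N_4)$ of the problem is positive: $N_i>0$ everywhere on its domain for $i=1,2,3,4$. This holds for both $\Sigma$ and $\Sigma_{\tau,\tau'}$.
   Context: The planar four-velocity Broadwell system, for unknown real functions $N_i=N_i(t,x,y)$, $i=1,\dots,4$, is $$\partial_t N_1+c\,\partial_x N_1=Q(N),\quad \partial_t N_2+c\,\partial_y N_2=-Q(N),\quad \partial_t N_3-c\,\partial_y N_3=-Q(N),\quad \partial_t N_4-c\,\partial_x N_4=Q(N),$$ with $Q(N)=2cS(N_2N_3-N_1N_4)$, where $c,S>0$ are constants. Problem $\Sigma_{\tau,\tau'}$ (for $[\tau,\tau']\subset[0,+\infty)$): the system on $[\tau,\tau']\times[a_1,b_1]\times[a_2,b_2]$ with the initial conditions $N_i(\tau,x,y)=N_i^\tau(x,y)$ for $(x,y)\in[a_1,b_1]\times[a_2,b_2]$, $i=1,\dots,4$, and the boundary conditions $N_1(t,a_1,y)=N_1^-(t,y)$, $N_2(t,x,a_2)=N_2^-(t,x)$, $N_3(t,x,b_2)=N_3^+(t,x)$, $N_4(t,b_1,y)=N_4^+(t,y)$ for $t\in[\tau,\tau']$, $x\in[a_1,b_1]$, $y\in[a_2,b_2]$. The data satisfy the compatibility conditions $N_1^\tau(a_1,y)=N_1^-(\tau,y)$,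 $N_2^\tau(x,a_2)=N_2^-(\tau,x)$, $N_3^\tau(x,b_2)=N_3^+(\tau,x)$, $N_4^\tau(b_1,y)=N_4^+(\tau,y)$. Problem $\Sigma$: the same problem with $\tau=0$ (initial data denoted $N_i^0$) and with the time interval $[\tau,\tau']$ replaced by $[0,+\infty)$. Standing assumptions: the data and their first-order partial derivatives are continuous and bounded, and the data are non-negative. A solution is a 4-tuple $N$ continuous on the domain, whose first-order partial derivatives exist and are continuous in the interior of the domain except possibly on the planes $x-c(t-\tau)=a_1$, $y-c(t-\tau)=a_2$, $y+c(t-\tau)=b_2$, $x+c(t-\tau)=b_1$ (with $\tau=0$ for $\Sigma$), which satisfies the system wherever these derivatives exist, together with the initial and boundary conditions. Solutions of these problems are known to be unique. *)

(* Defs.v *)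
From HB Require Import structures.
From mathcomp Require Import all_boot all_order all_algebra.
From mathcomp Require Import all_classical all_reals all_analysis.

Set Implicit Arguments.
Unset Strict Implicit.
Unset Printing Implicit Defensive.

Import Order.TTheory GRing.Theory Num.Theory.
Import numFieldNormedType.Exports.

Local Open Scope classical_set_scope.
Local Open Scope ring_scope.

(* The four velocities (c,0), (0,c), (0,-c), (-c,0), in this order. *)
Variant species := s1 | s2 | s3 | s4.

Section RegularityOfData.
Context {R : realType}.
Implicit Types (D : set (R * R)) (f : R * R -> R) (v p : R * R).

(* Derivative at p in the direction v relative to D: it is one-sided at the
   points of the boundary of D, and f is never evaluated outside D. *)
Definition is_derive_within D f v p (l : R) : Prop :=
  h^-1 * (f (p + h *: v) - f p)
    @[h --> within [set h : R | D (p + h *: v)] 0^'] --> l.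

Definition cont_bounded D f : Prop :=
  {within D, continuous f} /\ [bounded f p | p in D].

Definition cont_bounded_partial D f v : Prop :=
  exists2 g : R * R -> R,
    forall p, D p -> is_derive_within D f v p (g p) & cont_bounded D g.

Definition C1_bounded D f : Prop :=
  [/\ cont_bounded D f,
      cont_bounded_partial D f (1, 0) & cont_bounded_partial D f (0, 1)].

End RegularityOfData.

(* The time interval I, with initial time tau, is [tau, tau'] or [0, +oo[.
   Functions are total, but only their values on the relevant closed domains
   matter: init i is used on [a1, b1] x [a2, b2], bdry s1 and bdry s4 (functions
   of (t, y)) on I x [a2, b2], bdry s2 and bdry s3 (functions of (t, x)) on
   I x [a1, b1]. A point of space-time is ((t, x), y). *)
Section Problem.
Context {R : realType}.
Variables (c S a1 b1 a2 b2 : R) (I : set R) (tau : R).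
Implicit Types (init bdry : species -> R * R -> R).
Implicit Types (N : species -> R * R * R -> R) (p : R * R * R).

Definition rectangle : set (R * R) := `[a1, b1] `*` `[a2, b2].

Definition face (i : species) : set (R * R) :=
  match i with
  | s1 | s4 => I `*` `[a2, b2]
  | s2 | s3 => I `*` `[a1, b1]
  end.

Definition spacetime : set (R * R * R) := I `*` `[a1, b1] `*` `[a2, b2].

Definition compatible init bdry : Prop :=
  [/\ forall y, y \in `[a2, b2] -> init s1 (a1, y) = bdry s1 (tau, y),
      forall x, x \in `[a1, b1] -> init s2 (x, a2) = bdry s2 (tau, x),
      forall x, x \in `[a1, b1] -> init s3 (x, b2) = bdry s3 (tau, x) &
      forall y, y \in `[a2, b2] -> init s4 (b1, y) = bdry s4 (tau, y)].

Definition admissible_data init bdry : Prop :=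
  [/\ forall i, C1_bounded rectangle (init i),
      forall i, C1_bounded (face i) (bdry i),
      forall i q, rectangle q -> 0 <= init i q,
      forall i q, face i q -> 0 <= bdry i q &
      compatible init bdry].

Definition positive_data init bdry : Prop :=
  (forall i q, rectangle q -> 0 < init i q) /\
  (forall i q, face i q -> 0 < bdry i q).

Definition e_t : R * R * R := (1, 0, 0).
Definition e_x : R * R * R := (0, 1, 0).
Definition e_y : R * R * R := (0, 0, 1).

Definition collision N p : R :=
  2 * c * S * (N s2 p * N s3 p - N s1 p * N s4 p).

Definition broadwell_system N p : Prop :=
  [/\ 'D_e_t (N s1) p + c * 'D_e_x (N s1) p = collision N p,
      'D_e_t (N s2) p + c * 'D_e_y (N s2) p = - collision N p,
      'D_e_t (N s3) p - c * 'D_e_y (N s3) p = - collision N p &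
      'D_e_t (N s4) p - c * 'D_e_x (N s4) p = collision N p].

Definition exceptional_planes : set (R * R * R) :=
  [set p | let: (t, x, y) := p in
    [\/ x - c * (t - tau) = a1, y - c * (t - tau) = a2,
        y + c * (t - tau) = b2 | x + c * (t - tau) = b1]].

Definition partials_exist N p : Prop :=
  forall i, [/\ derivable (N i) p e_t, derivable (N i) p e_x
              & derivable (N i) p e_y].

Definition partials_continuous N p : Prop :=
  forall i, [/\ {for p, continuous ('D_e_t (N i))},
                {for p, continuous ('D_e_x (N i))}
              & {for p, continuous ('D_e_y (N i))}].

Definition initial_conditions init N : Prop :=
  forall i x y, rectangle (x, y) -> N i (tau, x, y) = init i (x, y).

Definition boundary_conditions bdry N : Prop :=
  [/\ forall t y, face s1 (t, y) -> N s1 (t, a1, y) = bdry s1 (t, y),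
      forall t x, face s2 (t, x) -> N s2 (t, x, a2) = bdry s2 (t, x),
      forall t x, face s3 (t, x) -> N s3 (t, x, b2) = bdry s3 (t, x) &
      forall t y, face s4 (t, y) -> N s4 (t, b1, y) = bdry s4 (t, y)].

Definition solution init bdry N : Prop :=
  [/\ forall i, {within spacetime, continuous (N i)},
      forall p, spacetime° p -> ~ exceptional_planes p ->
        partials_exist N p /\ partials_continuous N p,
      forall p, spacetime° p -> partials_exist N p -> broadwell_system N p,
      initial_conditions init N &
      boundary_conditions bdry N].

Definition positive_on_domain N : Prop := forall i p, spacetime p -> 0 < N i p.

End Problem.

(* Main.v *)
Require Import Defs.
From mathcomp Require Import all_boot all_order all_algebra.
From mathcomp Require Import all_classical all_reals all_analysis.
From mathcomp Require Import ring lra.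
Set Implicit Arguments.
Unset Strict Implicit.
Unset Printing Implicit Defensive.

Import Order.TTheory GRing.Theory Num.Theory.
Import numFieldNormedType.Exports.
Local Open Scope classical_set_scope.
Local Open Scope ring_scope.

(** Every density is transported along straight lines: with the velocity $v_i$
of species $i$, the system reads $D_{v_i} N_i = 2cS (G_i - N_i N_{i'})$, where
$i'$ is the opposite species and the gain $G_i$ is the product of the other two
densities.  As long as all densities are non-negative, $G_i \ge 0$, and if
$2cS N_{i'} \le K$ then $N_i$ multiplied by the exponential of $K$ times the
elapsed time increases along every characteristic of species $i$.  A
characteristic that is followed backwards meets the initial time or the inflow
face of $i$, where $N_i \ge m > 0$ by positivity of the data and compactness.
So $N_i \ge m e^{-K(T-\tau)}$ on a slab of duration $T - \tau$ on which the
densities are positive.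

If some density were non-positive somewhere, the set of the points where this
happens, up to the time of the given point, would be compact
([first_nonpositive_point]).  Take the first time $T$ at which it is met.  All
densities are positive before $T$, so the lower bound
([transport_lower_bound]) holds before $T$, and continuity contradicts the
non-positive value at time $T$ ([positive_solution]).

Two features of the notion of solution need care.
- The equations hold in terms of partial derivatives, while the argument
  uses the derivative along a characteristic.  Continuity of one partial
  derivative is what allows adding the two directions
  ([is_derive_sum_directions], [transport_equation]).
- Nothing is known on the boundary of the domain and on the exceptional
  planes, which may contain whole characteristics.  From a point off the
  planes, however, a line meets each plane at most once
  ([off_planes_along_line]), and monotonicity survives finitely many
  exceptions ([le_off_finite_set]).  As the interior points off the planes are
  dense ([generic_points_dense]), the bound is only ever needed at such
  points. *)

(** * Directional derivatives *)

(** Both difference quotients are the same function, so derivatives in a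
direction reduce to derivatives in one real variable. *)
Lemma is_derive_along_line (R : realType) (V : normedModType R) (f : V -> R)
    (q v : V) (r l : R) :
  is_derive (r *: v + q) v f l <->
  is_derive r 1 (fun h : R => f (h *: v + q)) l.
Proof.
have quotE : (fun h : R => h^-1 *: ((f \o shift (r *: v + q)) (h *: v)
                                    - f (r *: v + q))) =
    (fun h : R => h^-1 *: (((fun k : R => f (k *: v + q)) \o shift r)
                              (h *: (1 : R)) - f (r *: v + q))).
  apply/funext => h /=; congr (_ *: (f _ - _)).
  by rewrite addrA -scalerDl [h *: 1]mulr1.
split=> -[dq dql]; apply: DeriveDef.
- by move: dq; rewrite /derivable quotE.
- by move: dql; rewrite /derive quotE.
- by move: dq; rewrite /derivable quotE.
- by move: dql; rewrite /derive quotE.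
Qed.

Lemma is_derive_mull (R : realType) (a x : R) :
  is_derive x 1 (fun h : R => a * h) a.
Proof.
suff : is_derive x 1 (a \*: (id : R -> R)) (a *: 1) by rewrite [_ *: 1]mulr1.
exact: is_deriveZ.
Qed.

Lemma is_derive_scale_direction (R : realType) (V : normedModType R)
    (f : V -> R) (p v : V) (a l : R) :
  is_derive p v f l -> is_derive p (a *: v) f (a * l).
Proof.
move=> fpl; rewrite -[p]add0r -(scale0r (a *: v)).
apply: (proj2 (is_derive_along_line _ _ _ _ _)).
have -> : (fun h : R => f (h *: (a *: v) + p)) =
          (fun h : R => f (h *: v + p)) \o (fun h : R => a * h).
  by apply/funext => h /=; rewrite scalerA mulrC.
rewrite mulrC; apply: is_derive1_comp.
  apply: (proj1 (is_derive_along_line _ _ _ _ _)).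
  by rewrite mulr0 scale0r add0r.
exact: is_derive_mull.
Qed.

(** Parametrizing the segment by $[0, 1]$ instead of by the interval with ends
$0$ and $h$ avoids a discussion on the sign of $h$. *)
Lemma mean_value_along_line (R : realType) (V : normedModType R) (f : V -> R)
    (q v : V) (h : R) :
  (forall k : R, `|k| <= `|h| -> derivable f (k *: v + q) v) ->
  exists2 k : R, `|k| <= `|h| &
    f (h *: v + q) - f q = h * 'D_v f (k *: v + q).
Proof.
move=> df.
pose g (r : R) := f (r *: (h *: v) + q).
pose dg (r : R) := h * 'D_v f ((r * h) *: v + q).
have le_h (r : R) : r \in `[0, 1] -> `|r * h| <= `|h|.
  rewrite in_itv /= => /andP[r0 r1].
  by rewrite normrM ger0_norm// ler_piMl.
have gP (r : R) : r \in `[0, 1] -> is_derive r 1 g (dg r).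
  move=> r01; apply: (proj1 (is_derive_along_line _ _ _ _ _)).
  apply: is_derive_scale_direction.
  by rewrite scalerA; apply/derivableP/df/le_h.
have gc : {within `[0, 1], continuous g}.
  by apply: derivable_within_continuous => r /gP[].
have gPo (r : R) : r \in `]0, 1[ -> is_derive r 1 g (dg r).
  by move=> /subset_itv_oo_cc; exact: gP.
have [r r01] := @MVT_segment R g dg 0 1 ler01 gPo gc.
rewrite subr0 mulr1 /g /dg scale1r scale0r add0r => ->.
by exists (r * h); first exact: le_h.
Qed.

(** Write the increment of [f] along $h(v + w)$ as the increment along $hw$ from
[p], followed by the increment along $hv$ from $p + hw$.  The second one is
$h$ times a value of ['D_v f] close to [p], by the mean value theorem; this is
where continuity of ['D_v f] enters, and why differentiability along [w] is
only asked at [p]. *)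
Lemma is_derive_sum_directions (R : realType) (V : normedModType R)
    (f : V -> R) (p v w : V) :
  (\forall q \near p, derivable f q v) -> {for p, continuous ('D_v f)} ->
  derivable f p w -> is_derive p (v + w) f ('D_v f p + 'D_w f p).
Proof.
move=> dfv cfv dfw.
suff dq : (fun h => h^-1 *: ((f \o shift p) (h *: (v + w)) - f p)) @ 0^' -->
          'D_v f p + 'D_w f p.
  by apply: DeriveDef; [exact: cvgP dq|exact: cvg_lim dq].
have dqw : (fun h => h^-1 *: ((f \o shift p) (h *: w) - f p)) @ 0^'
    --> 'D_w f p.
  exact: dfw.
suff dqv : (fun h => h^-1 *: (f (h *: v + (h *: w + p)) - f (h *: w + p))) @ 0^'
    --> 'D_v f p.
  rewrite [X in X @ _](_ : _ =
      (fun h => h^-1 *: (f (h *: v + (h *: w + p)) - f (h *: w + p))) \+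
      (fun h => h^-1 *: ((f \o shift p) (h *: w) - f p))).
    exact: cvgD dqv dqw.
  apply/funext => h /=; rewrite -[RHS]scalerDr addrA subrK.
  by rewrite [h *: (v + w)]scalerDr -[_ + _ + p]addrA.
apply/cvgrPdist_lt => e e0.
have /nbhs_ballP[d /= d0 dP] :
    nbhs p [set q | derivable f q v /\ `|'D_v f p - 'D_v f q| < e].
  apply: filterI; first exact: dfv.
  by move/cvgrPdist_lt : cfv; exact.
near=> h.
have nearp (k : R) : `|k| <= `|h| -> ball p d (k *: v + (h *: w + p)).
  move=> kh; rewrite -ball_normE /= addrA opprD addrCA subrr addr0 normrN.
  apply: (@le_lt_trans _ _ (`|h| * (`|v| + `|w| + 1))).
    rewrite (le_trans (ler_normD _ _))// !normrZ -addrA 2!mulrDr lerD//.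
      exact: ler_wpM2r.
    by rewrite lerDl mulr_ge0.
  rewrite -ltr_pdivlMr ?ltr_pwDr//.
  by near: h; apply: dnbhs0_lt; rewrite divr_gt0// ltr_pwDr.
have [k kh ->] := mean_value_along_line (fun k kh => (dP _ (nearp k kh)).1).
rewrite [_ *: _]mulrA mulVf ?mul1r; last by near: h; exact: nbhs_dnbhs_neq.
by have [] := dP _ (nearp k kh).
Unshelve. all: by end_near. Qed.

(** * Monotonicity on the real line *)

(** Splitting the interval at an exceptional point leaves fewer of them in each
half, down to the usual mean value theorem; continuity glues the halves. *)
Lemma le_off_finite_set (R : realType) (f : R -> R) (E : seq R) (a b : R) :
  a <= b -> {within `[a, b], continuous f} ->
  (forall x, a < x < b -> x \notin E ->
    exists2 l, is_derive x 1 f l & 0 <= l) ->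
  f a <= f b.
Proof.
elim: E a b => [|e E IH] a b le_ab cf df.
  have dfD (x : R) : x \in `]a, b[ -> is_derive x 1 f ('D_1 f x).
    by rewrite in_itv /= => /df[//|l [dfx _] _]; exact: derivableP.
  move: le_ab; rewrite le_eqVlt => /predU1P[-> //|lt_ab].
  have [x + fE] := @MVT R f (fun x => 'D_1 f x) a b lt_ab dfD cf.
  rewrite in_itv /= => /df[//|l [_ <-] l0].
  by rewrite -subr_ge0 fE mulr_ge0// subr_ge0 ltW.
have [/andP[lt_ae lt_eb]|eNab] := boolP (a < e < b); last first.
  apply: (IH _ _ le_ab cf) => x xab xE; apply: df => //.
  by rewrite in_cons negb_or xE andbT; apply: contraNN eNab => /eqP <-.
apply: (@le_trans _ _ (f e)); apply: IH.
- exact: ltW.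
- apply: continuous_subspaceW cf; apply: subset_itvl.
  by rewrite bnd_simp ltW.
- move=> x /andP[ax xe] xE; apply: df; first by rewrite ax (lt_trans xe).
  by rewrite in_cons negb_or lt_eqF.
- exact: ltW.
- apply: continuous_subspaceW cf; apply: subset_itvr.
  by rewrite bnd_simp ltW.
- move=> x /andP[ex xb] xE; apply: df; first by rewrite xb (lt_trans lt_ae).
  by rewrite in_cons negb_or gt_eqF.
Qed.

Lemma within_continuous_precomp (S T U : topologicalType) (A : set T)
    (B : set S) (f : T -> U) (g : S -> T) :
  {within A, continuous f} -> continuous g -> (forall s, B s -> A (g s)) ->
  {within B, continuous (f \o g)}.
Proof.
move=> /subspace_continuousP cf cg gBA; apply/subspace_continuousP => s Bs.
apply: cvg_comp (cf _ (gBA _ Bs)) => P /cg; rewrite /nbhs /= => gP.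
by apply: filterS gP => r gPr /gBA/gPr.
Qed.

(** * The system as transport along characteristics *)

(** The time component 1 makes these the directions of the characteristics in
space-time. *)
Definition velocity {R : realType} (c : R) (i : species) : R * R * R :=
  match i with
  | s1 => (1, c, 0) | s2 => (1, 0, c) | s3 => (1, 0, - c) | s4 => (1, - c, 0)
  end.

Definition opposite (i : species) : species :=
  match i with s1 => s4 | s2 => s3 | s3 => s2 | s4 => s1 end.

Definition gain {R : realType} (N : species -> R * R * R -> R) (i : species)
    (p : R * R * R) : R :=
  match i with
  | s1 | s4 => N s2 p * N s3 p
  | s2 | s3 => N s1 p * N s4 p
  end.

(** The equations of [s2] and [s3] carry the opposite of the collision term, so
that in all four cases the pair of colliding partners [i], [opposite i] is lost
and the other pair is gained. *)
Lemma transport_equation (R : realType) (c S : R)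
    (N : species -> R * R * R -> R) (p : R * R * R) (i : species) :
  (\forall q \near p, partials_exist N q) -> partials_continuous N p ->
  broadwell_system c S N p ->
  is_derive p (velocity c i) (N i)
    (2 * c * S * (gain N i p - N i p * N (opposite i) p)).
Proof.
rewrite /broadwell_system /collision => Nd Nc [sys1 sys2 sys3 sys4].
have dNt : \forall q \near p, derivable (N i) q e_t.
  by apply: filterS Nd => q /(_ i)[].
have [dx dy] : derivable (N i) p e_x /\ derivable (N i) p e_y.
  by have [] := nbhs_singleton Nd i.
have [ct _ _] := Nc i.
have dN (a : R) w : derivable (N i) p w ->
    is_derive p (e_t + a *: w) (N i) ('D_e_t (N i) p + a * 'D_w (N i) p).
  move=> /derivableP dNw.
  have [dw <-] := @is_derive_scale_direction _ _ _ _ _ a _ dNw.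
  exact: (is_derive_sum_directions dNt ct dw).
have xE (a : R) : (1, a, 0) = e_t + a *: e_x.
  by rewrite /e_t /e_x; congr ((_, _), _) => /=; rewrite /GRing.scale /=; ring.
have yE (a : R) : (1, 0, a) = e_t + a *: e_y.
  by rewrite /e_t /e_y; congr ((_, _), _) => /=; rewrite /GRing.scale /=; ring.
case: i dNt dx dy ct dN => /= _ dx dy _ dN; rewrite ?xE ?yE.
- by have := dN c _ dx; rewrite sys1.
- by have := dN c _ dy; rewrite sys2; congr is_derive; ring.
- by have := dN (- c) _ dy; rewrite mulNr sys3; congr is_derive; ring.
- by have := dN (- c) _ dx; rewrite mulNr sys4; congr is_derive; ring.
Qed.

(** * Geometry of the domain *)

Definition open_slab {R : realType} (a1 b1 a2 b2 tau T : R) (p : R * R * R) :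
    Prop :=
  [/\ tau < p.1.1 < T, a1 < p.1.2 < b1 & a2 < p.2 < b2].

(** Distance to the face through which species [i] enters the rectangle. *)
Definition depth {R : realType} (a1 b1 a2 b2 : R) (i : species)
    (p : R * R * R) : R :=
  match i with
  | s1 => p.1.2 - a1 | s2 => p.2 - a2 | s3 => b2 - p.2 | s4 => b1 - p.1.2
  end.

(** The exceptional planes are the zero sets of these affine functions; the
plane of index [k] is formed by the characteristics of species [k] that start
from its inflow face at time [tau]. *)
Definition plane_gap {R : realType} (c a1 b1 a2 b2 tau : R) (k : species)
    (p : R * R * R) : R :=
  match k with
  | s1 => p.1.2 - c * (p.1.1 - tau) - a1
  | s2 => p.2 - c * (p.1.1 - tau) - a2
  | s3 => p.2 + c * (p.1.1 - tau) - b2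
  | s4 => p.1.2 + c * (p.1.1 - tau) - b1
  end.

(** Linear part of [plane_gap]. *)
Definition plane_slope {R : realType} (c : R) (k : species)
    (v : R * R * R) : R :=
  match k with
  | s1 => v.1.2 - c * v.1.1 | s2 => v.2 - c * v.1.1
  | s3 => v.2 + c * v.1.1 | s4 => v.1.2 + c * v.1.1
  end.

Definition off_planes {R : realType} (c a1 b1 a2 b2 tau : R) (p : R * R * R) :
    Prop :=
  forall k, plane_gap c a1 b1 a2 b2 tau k p != 0.

Lemma off_planesP (R : realType) (c a1 b1 a2 b2 tau : R) (p : R * R * R) :
  off_planes c a1 b1 a2 b2 tau p <-> ~ exceptional_planes c a1 b1 a2 b2 tau p.
Proof.
case: p => [[t x] y]; rewrite /off_planes /exceptional_planes /=; split.
  move=> off; case=> pE; [have := off s1|have := off s2|have := off s3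
    |have := off s4]; by rewrite /= subr_eq0 pE eqxx.
move=> Nexc k; apply/eqP => kE; apply: Nexc; case: k kE => /= /subr0_eq kE.
- exact: Or41.
- exact: Or42.
- exact: Or43.
- exact: Or44.
Qed.

Lemma plane_gap_along_line (R : realType) (c a1 b1 a2 b2 tau s : R)
    (k : species) (v p : R * R * R) :
  plane_gap c a1 b1 a2 b2 tau k (s *: v + p) =
  plane_gap c a1 b1 a2 b2 tau k p + s * plane_slope c k v.
Proof.
by case: k v p => [] [[v1 v2] v3] [[t x] y] /=; rewrite /GRing.scale /=; ring.
Qed.

(** A line that starts off a plane is not contained in it, hence meets it at one
parameter at most.  When the line is parallel to the plane, the listed quotient
has denominator 0 and the corresponding entry is harmless. *)
Lemma off_planes_along_line (R : realType) (c a1 b1 a2 b2 tau s : R)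
    (v p : R * R * R) :
  off_planes c a1 b1 a2 b2 tau p ->
  s \notin [seq - plane_gap c a1 b1 a2 b2 tau k p / plane_slope c k v
           | k <- [:: s1; s2; s3; s4]] ->
  off_planes c a1 b1 a2 b2 tau (s *: v + p).
Proof.
move=> off + k; rewrite plane_gap_along_line; apply: contraNneq => gap0.
have slope0 : plane_slope c k v != 0.
  apply/eqP => slope0; have := off k.
  by move: gap0; rewrite slope0 mulr0 addr0 => ->; rewrite eqxx.
have -> : s = - plane_gap c a1 b1 a2 b2 tau k p / plane_slope c k v.
  apply: (mulIf slope0); rewrite divfK//.
  by apply/eqP; rewrite -addr_eq0 addrC gap0.
by case: k {gap0 slope0}; rewrite !inE eqxx ?orbT.
Qed.

Lemma continuous_time (R : realType) : continuous (fun p : R * R * R => p.1.1).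
Proof. by move=> p; apply: cvg_comp; exact: cvg_fst. Qed.

Lemma continuous_abscissa (R : realType) :
  continuous (fun p : R * R * R => p.1.2).
Proof. by move=> p; apply: cvg_comp; [exact: cvg_fst|exact: cvg_snd]. Qed.

Lemma continuous_ordinate (R : realType) :
  continuous (fun p : R * R * R => p.2).
Proof. by move=> p; exact: cvg_snd. Qed.

Lemma continuous_depth (R : realType) (a1 b1 a2 b2 : R) (i : species) :
  continuous (depth a1 b1 a2 b2 i).
Proof.
move=> p; have cx := @continuous_abscissa R p.
have cy := @continuous_ordinate R p.
by case: i; apply: cvgB => //; exact: cvg_cst.
Qed.

Lemma continuous_plane_gap (R : realType) (c a1 b1 a2 b2 tau : R)
    (k : species) :
  continuous (plane_gap c a1 b1 a2 b2 tau k).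
Proof.
move=> p; have cx := @continuous_abscissa R p.
have cy := @continuous_ordinate R p.
have ct : c * (q.1.1 - tau) @[q --> p] --> c * (p.1.1 - tau).
  apply: cvgM; first exact: cvg_cst.
  by apply: cvgB; [exact: continuous_time|exact: cvg_cst].
by case: k; (apply: cvgB; last exact: cvg_cst);
  [apply: cvgB|apply: cvgB|apply: cvgD|apply: cvgD].
Qed.

Lemma near_off_planes (R : realType) (c a1 b1 a2 b2 tau : R) (p : R * R * R) :
  off_planes c a1 b1 a2 b2 tau p ->
  \forall q \near p, off_planes c a1 b1 a2 b2 tau q.
Proof.
move=> off.
have near_off k : \forall q \near p, plane_gap c a1 b1 a2 b2 tau k q != 0.
  exact: (cvgr_neq0 _ (@continuous_plane_gap _ _ _ _ _ _ _ _ p) (off k)).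
near=> q; case; near: q; exact: near_off.
Unshelve. all: by end_near. Qed.

Lemma near_open_slab (R : realType) (a1 b1 a2 b2 tau T : R) (p : R * R * R) :
  open_slab a1 b1 a2 b2 tau T p ->
  \forall q \near p, open_slab a1 b1 a2 b2 tau T q.
Proof.
move=> [/andP[tau_t t_T] /andP[a1_x x_b1] /andP[a2_y y_b2]].
have ct := @continuous_time R p; have cx := @continuous_abscissa R p.
have cy := @continuous_ordinate R p.
near=> q; split; apply/andP; split; near: q.
- exact: (cvgr_gt _ ct _ tau_t).
- exact: (cvgr_lt _ ct _ t_T).
- exact: (cvgr_gt _ cx _ a1_x).
- exact: (cvgr_lt _ cx _ x_b1).
- exact: (cvgr_gt _ cy _ a2_y).
- exact: (cvgr_lt _ cy _ y_b2).
Unshelve. all: by end_near. Qed.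

Lemma open_slab_spacetime (R : realType) (a1 b1 a2 b2 tau T : R) (I : set R)
    (p : R * R * R) :
  `]tau, T[ `<=` I ->
  open_slab a1 b1 a2 b2 tau T p -> spacetime a1 b1 a2 b2 I p.
Proof.
move=> sI [tp xp yp]; split=> [|/=]; last first.
  by rewrite in_itv /= !ltW ?(andP yp).1 ?(andP yp).2.
split=> /=; first by apply: sI; rewrite /= in_itv.
by rewrite in_itv /= !ltW ?(andP xp).1 ?(andP xp).2.
Qed.

(** * Lower bound along characteristics *)

Lemma characteristic_time (R : realType) (c s : R) (i : species)
    (p : R * R * R) :
  (s *: velocity c i + p).1.1 = s + p.1.1.
Proof.
by case: i p => [] [[t x] y] /=; rewrite [_ *: 1]mulr1.
Qed.

Lemma characteristic_depth (R : realType) (c a1 b1 a2 b2 s : R) (i : species)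
    (p : R * R * R) :
  depth a1 b1 a2 b2 i (s *: velocity c i + p) = depth a1 b1 a2 b2 i p + s * c.
Proof. by case: i p => [] [[t x] y] /=; rewrite /GRing.scale /=; ring. Qed.

(** Going backwards, species [i] moves away from its outflow face, and its other
coordinate does not change: only the initial time and the inflow face can be
hit. *)
Lemma characteristic_in_open_slab (R : realType) (c a1 b1 a2 b2 tau T s : R)
    (i : species) (p : R * R * R) :
  0 < c -> open_slab a1 b1 a2 b2 tau T p -> s <= 0 ->
  tau < (s *: velocity c i + p).1.1 ->
  0 < depth a1 b1 a2 b2 i (s *: velocity c i + p) ->
  open_slab a1 b1 a2 b2 tau T (s *: velocity c i + p).
Proof.
move=> c0 [tp xp yp] s0; rewrite characteristic_time characteristic_depth.
have sc0 : s * c <= 0 by rewrite mulr_le0_ge0// ltW.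
case: p tp xp yp => [[t x] y] /= tp xp yp tau_s ds.
have ts : tau < s + t < T by lra.
split; first by rewrite characteristic_time.
  by case: i ds => /= ds; rewrite /GRing.scale /=; lra.
by case: i ds => /= ds; rewrite /GRing.scale /=; lra.
Qed.

Lemma characteristic_in_spacetime (R : realType) (c a1 b1 a2 b2 tau T s : R)
    (i : species) (p : R * R * R) :
  0 < c -> open_slab a1 b1 a2 b2 tau T p -> s <= 0 ->
  tau <= (s *: velocity c i + p).1.1 ->
  0 <= depth a1 b1 a2 b2 i (s *: velocity c i + p) ->
  spacetime a1 b1 a2 b2 `[tau, T] (s *: velocity c i + p).
Proof.
move=> c0 [tp xp yp] s0; rewrite characteristic_time characteristic_depth.
have sc0 : s * c <= 0 by rewrite mulr_le0_ge0// ltW.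
case: p tp xp yp => [[t x] y] /= tp xp yp tau_s ds.
have ts : tau <= s + t <= T by lra.
split; first split; rewrite /mkset in_itv /=.
- by case: i {ds} => /=; rewrite [_ *: 1]mulr1.
- by case: i ds => /= ds; rewrite /GRing.scale /=; lra.
- by case: i ds => /= ds; rewrite /GRing.scale /=; lra.
Qed.

(** Along the backward characteristic from [p] up to the first hit of the
initial time or of the inflow face, [f] times the exponential of [K] times the
parameter has derivative $e^{Ks} (D_v f + K f) \ge 0$, except where an
exceptional plane is crossed.  The duration of this backward travel is at most
[T - tau]. *)
Lemma transport_lower_bound (R : realType) (c a1 b1 a2 b2 tau T K m : R)
    (i : species) (f : R * R * R -> R) (p : R * R * R) :
  0 < c -> 0 <= K ->
  {within spacetime a1 b1 a2 b2 `[tau, T], continuous f} ->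
  (forall q, open_slab a1 b1 a2 b2 tau T q ->
    off_planes c a1 b1 a2 b2 tau q ->
    exists2 l, is_derive q (velocity c i) f l & 0 <= l + K * f q) ->
  (forall q, spacetime a1 b1 a2 b2 `[tau, T] q ->
    q.1.1 = tau \/ depth a1 b1 a2 b2 i q = 0 -> m <= f q) ->
  open_slab a1 b1 a2 b2 tau T p -> off_planes c a1 b1 a2 b2 tau p ->
  0 <= f p -> m <= f p * expR (K * (T - tau)).
Proof.
move=> c0 K0 cf df fm slab_p off_p fp0.
pose v := velocity c i; pose d := depth a1 b1 a2 b2 i.
(* The time needed to reach the initial time or the inflow face. *)
pose s0 := Num.min (p.1.1 - tau) (d p / c).
have [/andP[tau_t t_T] _ _] := slab_p.
have dp0 : 0 < d p.
  by case: slab_p => _; rewrite /d; case: i {v d s0 df fm} => /=; lra.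
have s0_gt0 : 0 < s0 by rewrite lt_min subr_gt0 tau_t divr_gt0.
have s0_le_t : s0 <= p.1.1 - tau by rewrite ge_min lexx.
have s0_le_d : s0 * c <= d p.
  by rewrite -ler_pdivlMr// ge_min lexx orbT.
have inside (s : R) : - s0 < s <= 0 ->
    open_slab a1 b1 a2 b2 tau T (s *: v + p).
  move=> /andP[s0_s s_le0]; apply: characteristic_in_open_slab => //.
    by rewrite characteristic_time; lra.
  rewrite characteristic_depth -/d.
  have : - s0 * c < s * c by rewrite ltr_pM2r.
  lra.
have closed_inside (s : R) : - s0 <= s <= 0 ->
    spacetime a1 b1 a2 b2 `[tau, T] (s *: v + p).
  move=> /andP[s0_s s_le0]; apply: characteristic_in_spacetime => //.
    by rewrite characteristic_time; lra.
  rewrite characteristic_depth -/d.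
  have : - s0 * c <= s * c by rewrite ler_pM2r.
  lra.
pose g (s : R) := f (s *: v + p) * expR (K * s).
have cg : {within `[- s0, 0], continuous g}.
  have cfl : {within `[- s0, 0], continuous (f \o (fun s => s *: v + p))}.
    apply: within_continuous_precomp cf _ _.
      move=> r; apply: cvgD; last exact: cvg_cst.
      by apply: cvgZr_tmp; exact: cvg_id.
    by move=> r; rewrite /= in_itv; exact: closed_inside.
  have ce : {within `[- s0, 0], continuous (fun s => expR (K * s))}.
    apply: continuous_subspaceT => r.
    apply: continuous_comp; last exact: continuous_expR.
    by apply: cvgM; [exact: cvg_cst|exact: cvg_id].
  by move=> s; exact: (cvgM (cfl s) (ce s)).
have foot_le : g (- s0) <= g 0.
  apply: (le_off_finite_set _ cg) => [|s /andP[s0_s s_lt0]].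
    by rewrite oppr_le0 ltW.
  have slab_s : open_slab a1 b1 a2 b2 tau T (s *: v + p).
    by apply: inside; rewrite s0_s ltW.
  move=> /(off_planes_along_line off_p) off_s.
  have [l dfl l0] := df _ slab_s off_s.
  exists (expR (K * s) * (l + K * f (s *: v + p))); last first.
    by rewrite mulr_ge0 ?expR_ge0.
  have dg : is_derive s 1 (fun s => f (s *: v + p)) l.
    exact: (proj1 (is_derive_along_line _ _ _ _ _)).
  have de : is_derive s 1 (fun s => expR (K * s)) (expR (K * s) * K).
    by apply: is_derive1_comp; exact: is_derive_mull.
  apply: is_derive_eq (is_deriveM dg de) _.
  by rewrite /GRing.scale /=; ring.
have foot_ge : m <= f (- s0 *: v + p).
  apply: fm; first by apply: closed_inside; rewrite lexx oppr_le0 ltW.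
  rewrite characteristic_time characteristic_depth -/d.
  rewrite /s0; case: (leP (p.1.1 - tau) (d p / c)) => _; [left|right].
    by ring.
  by rewrite mulNr divfK ?subrr// gt_eqF.
apply: (le_trans foot_ge).
have fE : f (- s0 *: v + p) = g (- s0) * expR (K * s0).
  by rewrite /g -mulrA -expRD mulrN addNr expR0 mulr1.
rewrite fE.
apply: (@le_trans _ _ (g 0 * expR (K * s0))).
  by rewrite ler_wpM2r ?expR_ge0.
rewrite /g scale0r add0r mulr0 expR0 mulr1 ler_wpM2l// ler_expR ler_wpM2l//.
lra.
Qed.

(** * Density of the generic points *)

Lemma near_left_notin (R : realType) (a : R) (E : seq R) :
  \forall r \near a^'-, r \notin E.
Proof.
elim: E => [|e E IH]; first exact: nearW.
have rNe : \forall r \near a^'-, r != e.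
  have [lt_ea|le_ae] := ltP e a.
    by apply: filterS (nbhs_left_gt lt_ea) => r /gt_eqF ->.
  by apply: filterS (nbhs_left_lt a) => r /lt_le_trans/(_ le_ae)/lt_eqF ->.
by apply: filterS2 rNe IH => r rNe rNE; rewrite in_cons negb_or rNe.
Qed.

Lemma open_segment_point (R : realType) (a b z z0 r : R) :
  a < z0 < b -> a <= z <= b -> 0 <= r -> r < 1 -> a < r * (z - z0) + z0 < b.
Proof.
move=> /andP[az0 z0b] /andP[az zb] r0 r1.
have zL : 0 <= r * (z - a) by rewrite mulr_ge0// subr_ge0.
have zR : 0 <= r * (b - z) by rewrite mulr_ge0// subr_ge0.
have z0L : 0 < (1 - r) * (z0 - a) by rewrite mulr_gt0// subr_gt0.
have z0R : 0 < (1 - r) * (b - z0) by rewrite mulr_gt0// subr_gt0.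
by apply/andP; split; nra.
Qed.

(** Join [p] to an interior point [p0] off the planes.  The segment is interior
except perhaps at [p], and by [off_planes_along_line], applied from [p0], it is
off the planes except at finitely many points; so its points close to [p] and
different from [p] are suitable. *)
Lemma generic_points_dense (R : realType) (c a1 b1 a2 b2 tau T : R)
    (p : R * R * R) (U : set (R * R * R)) :
  0 < c -> a1 < b1 -> a2 < b2 -> tau < T ->
  spacetime a1 b1 a2 b2 `[tau, T] p -> nbhs p U ->
  exists q, [/\ U q, open_slab a1 b1 a2 b2 tau T q &
                off_planes c a1 b1 a2 b2 tau q].
Proof.
move=> c0 ab1 ab2 tauT [[tp xp] yp] Up.
pose h := Num.min (T - tau) (Num.min ((b1 - a1) / c) ((b2 - a2) / c)) / 4.
have minh : h * 4 = Num.min (T - tau) (Num.min ((b1 - a1) / c) ((b2 - a2) / c)).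
  by rewrite divfK// pnatr_eq0.
have h0 : 0 < h.
  by rewrite divr_gt0// !lt_min !subr_gt0 tauT !divr_gt0 ?subr_gt0.
have hT : h * 4 <= T - tau by rewrite minh ge_min lexx.
have hx : h * 4 * c <= b1 - a1.
  by rewrite -ler_pdivlMr// minh !ge_min lexx orbT.
have hy : h * 4 * c <= b2 - a2.
  by rewrite -ler_pdivlMr// minh !ge_min lexx !orbT.
have hc : 0 < h * c by rewrite mulr_gt0.
(* At the centre of the rectangle, shortly after [tau]: the planes issued from
   the faces have not yet travelled half of the rectangle. *)
pose p0 : R * R * R := (tau + h, (a1 + b1) / 2, (a2 + b2) / 2).
have off0 : off_planes c a1 b1 a2 b2 tau p0.
  have cE : c * (tau + h - tau) = h * c by ring.
  case; rewrite /= cE; [rewrite gt_eqF|rewrite gt_eqF|rewrite lt_eqF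
    |rewrite lt_eqF] => //; lra.
pose q (r : R) := r *: (p - p0) + p0.
have cq : q r @[r --> 1^'-] --> p.
  have : q r @[r --> (1 : R)] --> q 1.
    by apply: cvgD; [apply: cvgZr_tmp; exact: cvg_id|exact: cvg_cst].
  rewrite [in X in _ --> X]/q scale1r subrK; exact: cvg_at_left_filter.
have Uq : \forall r \near 1^'-, U (q r) by exact: cq.
near (1 : R)^'- => r; exists (q r); split; first by near: r.
- have r0 : 0 <= r by near: r; apply: nbhs_left_ge.
  have r1 : r < 1 by near: r; apply: nbhs_left_lt.
  move: tp xp yp; rewrite /= !in_itv /= => tp xp yp.
  by split; apply: open_segment_point => //=; lra.
- apply: off_planes_along_line off0 _; near: r; exact: near_left_notin.
Unshelve. all: by end_near. Qed.

(** * Compactness arguments *)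

Lemma spacetime_compact (R : realType) (a1 b1 a2 b2 tau T : R) :
  compact (spacetime a1 b1 a2 b2 `[tau, T]).
Proof.
by apply: compact_setX; [apply: compact_setX|]; exact: segment_compact.
Qed.

Lemma compact_sublevel (R : realType) (T : topologicalType) (A : set T)
    (f : T -> R) (a : R) :
  hausdorff_space T -> compact A -> {within A, continuous f} ->
  compact (A `&` [set p | f p <= a]).
Proof.
move=> hT cA cf; apply: (subclosed_compact _ cA); last exact: subIsetl.
rewrite closed_setSI; last exact: compact_closed.
by move/continuous_closedP : cf => /(_ _ (@closed_le R a)).
Qed.

Lemma inflow_lower_bound (R : realType) (a1 b1 a2 b2 tau T : R) (i : species)
    (f : R * R * R -> R) :
  a1 < b1 -> a2 < b2 -> tau < T ->
  {within spacetime a1 b1 a2 b2 `[tau, T], continuous f} ->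
  (forall q, spacetime a1 b1 a2 b2 `[tau, T] q ->
    q.1.1 = tau \/ depth a1 b1 a2 b2 i q = 0 -> 0 < f q) ->
  exists2 m, 0 < m & forall q, spacetime a1 b1 a2 b2 `[tau, T] q ->
    q.1.1 = tau \/ depth a1 b1 a2 b2 i q = 0 -> m <= f q.
Proof.
move=> ab1 ab2 tauT cf f0.
(* The inflow set is the zero set of a single continuous function. *)
pose g q := (q.1.1 - tau) * depth a1 b1 a2 b2 i q.
have gP q : q.1.1 = tau \/ depth a1 b1 a2 b2 i q = 0 <-> g q = 0.
  rewrite /g; split=> [[->|->]|/eqP]; rewrite ?subrr ?mul0r ?mulr0//.
  by rewrite mulf_eq0 subr_eq0 => /orP[/eqP|/eqP]; [left|right].
pose A := spacetime a1 b1 a2 b2 `[tau, T] `&` g @^-1` [set 0].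
have cA : compact A.
  apply: compact_closedI; first exact: spacetime_compact.
  apply: closed_comp; last exact: closed_eq.
  move=> q _; apply: cvgM; last exact: continuous_depth.
  by apply: cvgB; [exact: continuous_time|exact: cvg_cst].
have A0 : A !=set0.
  exists (tau, a1, a2); split; last by rewrite /= /g subrr mul0r.
  by split; first split; rewrite /= in_itv /= lexx ltW.
have cfA : {within A, continuous f}.
  by apply: continuous_subspaceW cf; exact: subIsetl.
have [q] := compact_EVT_min A0 cA cfA.
rewrite inE => -[boxq /gP gq] qmin; exists (f q); first exact: f0.
by move=> r boxr /gP gr; apply: qmin; rewrite inE.
Qed.

Lemma inflow_positive (R : realType) (a1 b1 a2 b2 tau : R) (I : set R)
    (init bdry : species -> R * R -> R) (N : species -> R * R * R -> R)
    (i : species) (q : R * R * R) :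
  positive_data a1 b1 a2 b2 I init bdry ->
  initial_conditions a1 b1 a2 b2 tau init N ->
  boundary_conditions a1 b1 a2 b2 I bdry N ->
  spacetime a1 b1 a2 b2 I q ->
  q.1.1 = tau \/ depth a1 b1 a2 b2 i q = 0 -> 0 < N i q.
Proof.
move=> [init0 bdry0] ic [bc1 bc2 bc3 bc4].
case: q => [[t x] y] [[/= It xab] yab] [->|].
  by rewrite ic; [apply: init0|]; split.
case: i => /= /subr0_eq E; [rewrite E bc1|rewrite E bc2|rewrite -E bc3
  |rewrite -E bc4] => //; by [apply: bdry0; split|split].
Qed.

(** The points where some density is not positive form a finite union of compact
sets, on which the time coordinate attains its minimum. *)
Lemma first_nonpositive_point (R : realType) (a1 b1 a2 b2 tau T : R)
    (N : species -> R * R * R -> R) :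
  (forall i, {within spacetime a1 b1 a2 b2 `[tau, T], continuous (N i)}) ->
  (exists i p, spacetime a1 b1 a2 b2 `[tau, T] p /\ N i p <= 0) ->
  exists i p, [/\ spacetime a1 b1 a2 b2 `[tau, T] p, N i p <= 0 &
    forall j q, spacetime a1 b1 a2 b2 `[tau, T] q -> q.1.1 < p.1.1 ->
      0 < N j q].
Proof.
move=> cN [i [p [boxp Nip]]].
pose box := spacetime a1 b1 a2 b2 `[tau, T].
pose Z j := box `&` [set q | N j q <= 0].
have cZ j : compact (Z j).
  apply: compact_sublevel (cN j); last exact: spacetime_compact.
  exact: norm_hausdorff.
pose ZZ := Z s1 `|` Z s2 `|` Z s3 `|` Z s4.
have ZZP q : ZZ q <-> exists j, Z j q.
  split=> [[[[Zq|Zq]|Zq]|Zq]|[[] Zq]]; by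
    [exists s1|exists s2|exists s3|exists s4|do 3 left|do 2 left; right
    |left; right|right].
have cZZ : compact ZZ by do 3 (apply: compactU => //).
have ZZ0 : ZZ !=set0 by exists p; apply/ZZP; exists i.
have ct : {within ZZ, continuous (fun q : R * R * R => q.1.1)}.
  exact/continuous_subspaceT/continuous_time.
have [q] := compact_EVT_min ZZ0 cZZ ct.
rewrite inE => /ZZP[j [boxq Njq]] qmin; exists j, q; split=> // k r boxr rq.
rewrite ltNge; apply: contraTN rq => Nkr; rewrite -leNgt; apply: qmin.
by rewrite inE; apply/ZZP; exists k.
Qed.

(** * Positivity *)

Lemma solution_transport (R : realType) (c S a1 b1 a2 b2 tau T : R) (I : set R)
    (init bdry : species -> R * R -> R) (N : species -> R * R * R -> R)
    (i : species) (p : R * R * R) :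
  `]tau, T[ `<=` I -> solution c S a1 b1 a2 b2 I tau init bdry N ->
  open_slab a1 b1 a2 b2 tau T p -> off_planes c a1 b1 a2 b2 tau p ->
  is_derive p (velocity c i) (N i)
    (2 * c * S * (gain N i p - N i p * N (opposite i) p)).
Proof.
move=> sI [_ regN sysN _ _] slab_p off_p.
have near_int : \forall q \near p, (spacetime a1 b1 a2 b2 I)° q.
  apply: nbhs_interior; apply: filterS (near_open_slab slab_p) => q.
  exact: open_slab_spacetime.
have near_reg : \forall q \near p,
    partials_exist N q /\ partials_continuous N q.
  apply: filterS2 near_int (near_off_planes off_p) => q int_q /off_planesP.
  exact: regN.
have [part_p cont_p] := nbhs_singleton near_reg.
apply: transport_equation => //.
  by apply: filterS near_reg => q [part_q _].
by apply: sysN => //; exact: nbhs_singleton near_int.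
Qed.

(** The interval condition on [I] covers both the bounded and the unbounded time
interval: all that matters is the past of a given time. *)
Lemma positive_solution (R : realType) (c S a1 b1 a2 b2 tau : R) (I : set R)
    (init bdry : species -> R * R -> R) (N : species -> R * R * R -> R) :
  0 < c -> 0 < S -> a1 < b1 -> a2 < b2 ->
  (forall t, I t -> tau <= t /\ `[tau, t] `<=` I) ->
  positive_data a1 b1 a2 b2 I init bdry ->
  solution c S a1 b1 a2 b2 I tau init bdry N ->
  positive_on_domain a1 b1 a2 b2 I N.
Proof.
move=> c0 S0 ab1 ab2 Itv data sol i p Ip; have [cN _ _ ic bc] := sol.
have [//|Nip] := ltP 0 (N i p).
have subI t : I t ->
    spacetime a1 b1 a2 b2 `[tau, t] `<=` spacetime a1 b1 a2 b2 I.
  by move=> /Itv[_ tI] q [[/tI It xq] yq].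
have cNb t j :
    I t -> {within spacetime a1 b1 a2 b2 `[tau, t], continuous (N j)}.
  by move=> /subI tI; apply: continuous_subspaceW (cN j).
have It : I p.1.1 by have [[]] := Ip.
have boxp : spacetime a1 b1 a2 b2 `[tau, p.1.1] p.
  have [tau_t _] := Itv _ It.
  have [[_ xp] yp] := Ip; split=> //; split=> //=.
  by rewrite in_itv /= tau_t /=.
have [j [q [boxq Njq before]]] :=
  first_nonpositive_point (fun j => cNb _ j It)
    (ex_intro _ i (ex_intro _ p (conj boxp Nip))).
have {boxp Nip Ip i} [[]] := boxq; rewrite /= in_itv /= => /andP[tau_q q_p] _ _.
set T := q.1.1 in before tau_q q_p.
have IT : I T by apply: (Itv _ It).2; rewrite /= in_itv /= tau_q.
have Iq := subI _ It _ boxq.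
have boxTp : spacetime a1 b1 a2 b2 `[tau, T] `<=`
             spacetime a1 b1 a2 b2 `[tau, p.1.1].
  move=> r [[tr xr] yr]; split=> //; split=> //; move: tr.
  by rewrite /= !in_itv /= => /andP[-> /le_trans]; apply.
have inflow_pos k r : spacetime a1 b1 a2 b2 I r ->
    r.1.1 = tau \/ depth a1 b1 a2 b2 k r = 0 -> 0 < N k r.
  exact: inflow_positive data ic bc.
have tauT : tau < T.
  rewrite lt_neqAle tau_q andbT; apply: contraTN Njq => /eqP tauE.
  by rewrite -ltNge; apply: inflow_pos => //; left.
have boxTq : spacetime a1 b1 a2 b2 `[tau, T] q.
  have [[_ xq] yq] := boxq; split=> //; split=> //=.
  by rewrite in_itv /= tau_q /=.
have itvI : `]tau, T[ `<=` I.
  by move=> t ttT; apply: (Itv _ IT).2; exact: subset_itv_oo_cc.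
have itvT : `]tau, T[ `<=` `[tau, T] by exact: subset_itv_oo_cc.
have slab_pos k r : open_slab a1 b1 a2 b2 tau T r -> 0 < N k r.
  move=> slab_r; apply: before; first exact/boxTp/open_slab_spacetime/slab_r.
  by have [/andP[]] := slab_r.
have [m m0 mP] := inflow_lower_bound ab1 ab2 tauT
  (cNb _ j IT) (fun r boxr => inflow_pos j r (subI _ IT _ boxr)).
have [u _ uP] := compact_EVT_max (ex_intro _ q boxTq)
  (@spacetime_compact R a1 b1 a2 b2 tau T) (cNb _ (opposite j) IT).
(* Only the loss term can make [N j] decrease, at a rate at most [K]. *)
pose M := Num.max 0 (N (opposite j) u).
have M0 : 0 <= M by rewrite le_max lexx.
have MP r : spacetime a1 b1 a2 b2 `[tau, T] r -> N (opposite j) r <= M.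
  by move=> boxr; rewrite le_max uP ?orbT// inE.
pose K := 2 * c * S * M.
have cS0 : 0 <= 2 * c * S by rewrite !mulr_ge0// ltW.
have K0 : 0 <= K by rewrite mulr_ge0.
have transport r : open_slab a1 b1 a2 b2 tau T r ->
    off_planes c a1 b1 a2 b2 tau r ->
    exists2 l, is_derive r (velocity c j) (N j) l & 0 <= l + K * N j r.
  move=> slab_r off_r.
  exists (2 * c * S * (gain N j r - N j r * N (opposite j) r)).
    exact: solution_transport itvI sol slab_r off_r.
  have gain0 : 0 <= gain N j r.
    by case: (j) => /=; rewrite mulr_ge0// ltW// slab_pos.
  have loss : N j r * N (opposite j) r <= M * N j r.
    rewrite [leRHS]mulrC; apply: ler_wpM2l; first exact/ltW/slab_pos.
    exact/MP/open_slab_spacetime/slab_r.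
  rewrite /K -[_ * M * _]mulrA -mulrDr mulr_ge0//.
  lra.
(* The value of [N j] at [q] is non-positive, so it is below the lower bound [e]
   near [q], in particular at a generic point before [T]. *)
pose e := m / expR (K * (T - tau)).
have e0 : 0 < e by rewrite divr_gt0 ?expR_gt0.
have near_small :
    nbhs q [set r | spacetime a1 b1 a2 b2 `[tau, T] r -> N j r < e].
  have /subspace_continuousP/(_ q boxTq) cq := cNb _ j IT.
  exact: (cvgr_lt _ cq _ (le_lt_trans Njq e0)).
have [r [small_r slab_r off_r]] :=
  generic_points_dense c0 ab1 ab2 tauT boxTq near_small.
have := transport_lower_bound c0 K0 (cNb _ j IT)
  transport mP slab_r off_r (ltW (slab_pos _ _ slab_r)).
rewrite -ler_pdivrMr ?expR_gt0// leNgt small_r//.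
exact: open_slab_spacetime slab_r.
Qed.

Unset Implicit Arguments.

Theorem theorem1p9 (R : realType) (c S a1 b1 a2 b2 : R)
    (c_gt0 : 0 < c) (S_gt0 : 0 < S) (a1_lt_b1 : a1 < b1) (a2_lt_b2 : a2 < b2) :
  (forall (init bdry : species -> R * R -> R) (N : species -> R * R * R -> R),
     admissible_data a1 b1 a2 b2 `[0, +oo[ 0 init bdry ->
     positive_data a1 b1 a2 b2 `[0, +oo[ init bdry ->
     solution c S a1 b1 a2 b2 `[0, +oo[ 0 init bdry N ->
     positive_on_domain a1 b1 a2 b2 `[0, +oo[ N) /\
  (forall (tau tau' : R), 0 <= tau -> tau < tau' ->
   forall (init bdry : species -> R * R -> R) (N : species -> R * R * R -> R),
     admissible_data a1 b1 a2 b2 `[tau, tau'] tau init bdry ->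
     positive_data a1 b1 a2 b2 `[tau, tau'] init bdry ->
     solution c S a1 b1 a2 b2 `[tau, tau'] tau init bdry N ->
     positive_on_domain a1 b1 a2 b2 `[tau, tau'] N).
Proof.
split=> [init bdry N _ data sol|tau tau' _ _ init bdry N _ data sol].
  apply: (positive_solution c_gt0 S_gt0 _ _ _ data sol) => //.
  move=> t /=; rewrite in_itv /= andbT => t0; split=> // s /=.
  by rewrite !in_itv /= andbT => /andP[].
apply: (positive_solution c_gt0 S_gt0 _ _ _ data sol) => //.
move=> t /=; rewrite in_itv /= => /andP[tau_t t_tau']; split=> // s /=.
by rewrite !in_itv /= => /andP[-> /le_trans]; apply.
Qed.
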